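(* Let $K,P\ge1$ be integers and let the times taken by each of $P$ workers to compute the gradient on one mini-batch be i.i.d. positive random variables (across workers and mini-batches) distributed as $X$, with $0<\mathbb{E}[X]<\infty$. Then the expected runtime per iteration of $K$-batch-async SGD, in the limit of a large number of iterations, is $$\mathbb{E}[T]=\frac{K\,\mathbb{E}[X]}{P}.$$
   Context: A central parameter server (PS) interacts with $P$ parallel workers, all starting at time $0$; everything other than gradient computation takes zero time. $K$-batch-async SGD: each worker, independently of the others, starts computing on a new mini-batch immediately after finishing (pushing) the previous one; the PS updates the parameter each time $K$ new pushes in total have been received, irrespective of which workers they come from, so every $K$ pushes are one iteration. The expected runtime per iteration in the limit of a large number of iterations is $\mathbb{E}[T]=\lim_{J\to\infty}\mathbb{E}[S_J]/J$, where $S_J$ is the time of the $J$-th update (the $JK$-th push). *)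

(* Defs.v *)
From HB Require Import structures.
From mathcomp Require Export all_boot all_order all_algebra.
From mathcomp Require Export finmap.
From mathcomp Require Export all_classical all_reals all_analysis.

Set Implicit Arguments.
Unset Strict Implicit.
Unset Printing Implicit Defensive.

Export Order.TTheory GRing.Theory Num.Theory.
Export numFieldNormedType.Exports.

Local Open Scope classical_set_scope.
Local Open Scope card_scope.
Local Open Scope ring_scope.

Definition mutually_independent d (Omega : measurableType d) (R : realType)
    (Pr : probability Omega R) (I : choiceType) (Y : I -> {RV Pr >-> R}) : Prop :=
  forall (J : {fset I}) (A : I -> set R), (forall i, measurable (A i)) ->
    Pr (\bigcap_(i in [set` J]) (Y i @^-1` A i)) =
    (\prod_(i <- J) Pr (Y i @^-1` A i))%E.

Definition identically_distributed d (Omega : measurableType d) (R : realType)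
    (Pr : probability Omega R) (Y Z : {RV Pr >-> R}) : Prop :=
  forall A : set R, measurable A -> distribution Pr Y A = distribution Pr Z A.

Definition iid_as d (Omega : measurableType d) (R : realType)
    (Pr : probability Omega R) (I : choiceType) (Y : I -> {RV Pr >-> R})
    (X : {RV Pr >-> R}) : Prop :=
  mutually_independent Y /\ forall i, identically_distributed (Y i) X.

Section KBatchAsync.
Variables (R : realType) (P : nat).
(* [x i k] is the time worker [i] takes on its [k]-th mini-batch, k = 0, 1, 2... *)
Variable x : 'I_P -> nat -> R.

(* Workers start at time 0 and never idle, so worker [i] pushes its [k]-th
   mini-batch once its mini-batches 0, ..., k have been processed. *)
Definition push_time (i : 'I_P) (k : nat) : R := \sum_(j < k.+1) x i j.

Definition pushes_by (t : R) : set ('I_P * nat) :=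
  [set p | push_time p.1 p.2 <= t].

(* First time at which the parameter server has received [n] pushes in
   total; simultaneous pushes are counted with multiplicity. *)
Definition nth_push_time (n : nat) : R :=
  inf [set t : R | 0 <= t /\ `I_n #<= pushes_by t].

(* Time of the [J]-th update when every [K] pushes make up one iteration. *)
Definition update_time (K J : nat) : R := nth_push_time (J * K).

End KBatchAsync.

(* Main.v *)
(* Let mu be the mean of X, q = (n - 1) / P (integer division) and m = q + 1.
   Write T_i for the time of the m-th push of worker i and S_n for the time of
   the n-th push overall. At time max_i T_i every worker has made m pushes, so
   at least m P >= n pushes have occurred; before min_i T_i every worker has made
   at most q pushes, so at most q P < n pushes have occurred. Therefore
   min_i T_i <= S_n <= max_i T_i and |S_n - m mu| <= sum_i |T_i - m mu|. By the
   L1 weak law of large numbers the expectation of the right-hand side is o(m),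
   and m = n / P + O(1), so E[S_n] / n --> mu / P.
   The L1 law holds for indicators by a second moment computation, for simple
   functions of the X_j by linearity, and in general by L1 approximation. *)
Require Import Defs.
From mathcomp Require Import measurable_realfun ring lra.

Set Implicit Arguments.
Unset Strict Implicit.
Unset Printing Implicit Defensive.

Local Open Scope classical_set_scope.
Local Open Scope ring_scope.
Local Open Scope ereal_scope.

(** * Integrals of nonnegative real-valued functions *)

Section NonnegativeRealIntegrals.
Context d (T : measurableType d) (R : realType).
Variable mu : {measure set T -> \bar R}.
Implicit Types f g : T -> R.

Lemma ge0_integral_EFin_sum (I : Type) (s : seq I) (f : I -> T -> R) :
  (forall i, measurable_fun [set: T] (f i)) -> (forall i w, (0 <= f i w)%R) ->
  \int[mu]_w (\sum_(i <- s) f i w)%R%:E = \sum_(i <- s) \int[mu]_w (f i w)%:E.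
Proof.
move=> mf f0; under eq_integral do rewrite -sumEFin.
rewrite ge0_integral_sum//.
- by move=> i; exact/measurable_EFinP.
- by move=> i w _; rewrite lee_fin.
Qed.

Lemma ge0_integral_EFinD f g :
  measurable_fun [set: T] f -> (forall w, (0 <= f w)%R) ->
  measurable_fun [set: T] g -> (forall w, (0 <= g w)%R) ->
  \int[mu]_w (f w + g w)%:E = \int[mu]_w (f w)%:E + \int[mu]_w (g w)%:E.
Proof.
move=> mf f0 mg g0; under eq_integral do rewrite EFinD.
by rewrite ge0_integralD//; do ?[exact/measurable_EFinP];
  move=> w _; rewrite lee_fin.
Qed.

Lemma ge0_integral_EFinZl f (k : R) :
  measurable_fun [set: T] f -> (forall w, (0 <= f w)%R) -> (0 <= k)%R ->
  \int[mu]_w (k * f w)%:E = k%:E * \int[mu]_w (f w)%:E.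
Proof.
move=> mf f0 k0; under eq_integral do rewrite EFinM.
by rewrite ge0_integralZl_EFin//; do ?[exact/measurable_EFinP];
  move=> w _; rewrite lee_fin.
Qed.

Lemma ge0_le_integral_EFin f g :
  measurable_fun [set: T] f -> (forall w, (0 <= f w)%R) ->
  measurable_fun [set: T] g -> (forall w, (f w <= g w)%R) ->
  \int[mu]_w (f w)%:E <= \int[mu]_w (g w)%:E.
Proof.
move=> mf f0 mg fg.
by apply: ge0_le_integral => //; do ?[exact/measurable_EFinP];
  move=> w _; rewrite lee_fin.
Qed.

End NonnegativeRealIntegrals.

Lemma integral_cst_prob d (T : measurableType d) (R : realType)
  (P : probability T R) (r : R) : \int[P]_w r%:E = r%:E.
Proof. by rewrite integral_cst//= probability_setT mule1. Qed.

(** * Moments of sums of indicators of pairwise independent, equiprobable events *)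

Section IndicatorSums.
Context d (T : measurableType d) (R : realType) (P : probability T R).
Variables (A : nat -> set T) (p : R).
Hypothesis mA : forall j, measurable (A j).
Hypothesis PA : forall j, P (A j) = p%:E.
Hypothesis PAA : forall j k, j != k -> P (A j `&` A k) = (p ^+ 2)%:E.

(** Pairwise independence makes the covariances vanish, so the integral is the variance
    [m * p * (1 - p)]; the cruder bound [m] suffices. *)
Lemma sum_indic_L2 (m : nat) :
  \int[P]_w ((\sum_(j < m) \1_(A j) w - m%:R * p) ^+ 2)%:E <= m%:R%:E.
Proof.
pose N w := (\sum_(j < m) \1_(A j) w)%R : R.
have p0 : (0 <= p)%R by rewrite -lee_fin -(PA 0%N).
have mN : measurable_fun [set: T] N.
  by apply: measurable_sum => j; exact: measurable_indic.
have N0 w : (0 <= N w)%R by apply: sumr_ge0 => j _; rewrite indicE.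
have IN : \int[P]_w (N w)%:E = (m%:R * p)%:E.
  rewrite ge0_integral_EFin_sum//; last by move=> j; exact: measurable_indic.
  under eq_bigr do rewrite integral_indic//= setIT PA.
  by rewrite sumEFin sumr_const card_ord mulr_natl.
have IN2 : \int[P]_w (N w ^+ 2)%:E <= (m%:R + (m%:R * p) ^+ 2)%:E.
  have N2 w : (N w ^+ 2 = \sum_(j < m) \sum_(k < m) \1_(A j `&` A k) w)%R.
    rewrite expr2 mulr_suml; apply: eq_bigr => j _.
    by rewrite mulr_sumr; apply: eq_bigr => k _; rewrite indicI.
  have mAA j k : measurable_fun [set: T] (\1_(A j `&` A k) : T -> R).
    by apply: measurable_indic; exact: measurableI.
  under eq_integral do rewrite N2.
  rewrite ge0_integral_EFin_sum.
  (* Each row of the double sum is at most [1 + m * p ^+ 2]: off the diagonal the terms equal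
     [p ^+ 2], and the diagonal term is at most 1, hence at most [1 + p ^+ 2]. *)
  - have -> : (m%:R + (m%:R * p) ^+ 2)%:E = \sum_(j < m) (1 + m%:R * p ^+ 2)%:E.
      by rewrite sumEFin sumr_const card_ord; congr EFin; rewrite -[RHS]mulr_natl; ring.
    apply: lee_sum => j _; rewrite ge0_integral_EFin_sum//.
    have -> : (1 + m%:R * p ^+ 2)%:E = \sum_(k < m) ((k == j)%:R + p ^+ 2)%:E.
      rewrite sumEFin big_split/= sumr_const card_ord mulr_natl.
      by rewrite (bigD1 j)//= eqxx big1 ?addr0// => k /negbTE ->.
    apply: lee_sum => k _; rewrite integral_indic//=; last exact: measurableI.
    rewrite setIT.
    have [->|kj] := eqVneq k j; last by rewrite PAA ?add0r// eq_sym.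
    rewrite (le_trans (probability_le1 _ _)) ?lee_fin//; first exact: measurableI.
    by rewrite lerDl sqr_ge0.
  - by move=> j; exact: measurable_sum.
  - by move=> j w; exact: sumr_ge0.
have c0 : (0 <= 2 * (m%:R * p))%R by rewrite !mulr_ge0.
(* Adding the integral of [2 * (m * p) * N] to both sides cancels the negative cross term of the
   square, so that only nonnegative integrands occur. *)
have : \int[P]_w ((N w - m%:R * p) ^+ 2)%:E + (2 * (m%:R * p) ^+ 2)%:E
     <= m%:R%:E + (2 * (m%:R * p) ^+ 2)%:E.
  have -> : (2 * (m%:R * p) ^+ 2)%:E = \int[P]_w (2 * (m%:R * p) * N w)%:E.
    by rewrite ge0_integral_EFinZl// IN -EFinM; congr EFin; ring.
  rewrite -ge0_integral_EFinD; last 4 first.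
  - by apply: measurable_funX; exact: measurable_funB.
  - by move=> w; exact: sqr_ge0.
  - exact: measurable_funM.
  - by move=> w; rewrite mulr_ge0.
  have sq w : ((N w - m%:R * p) ^+ 2 + 2 * (m%:R * p) * N w =
               N w ^+ 2 + (m%:R * p) ^+ 2)%R by ring.
  under eq_integral do rewrite sq.
  rewrite ge0_integral_EFinD; last 4 first.
  - exact: measurable_funX.
  - by move=> w; exact: sqr_ge0.
  - exact: measurable_cst.
  - by move=> w; exact: sqr_ge0.
  rewrite integral_cst_prob ge0_integral_EFinZl// IN -EFinM.
  rewrite (le_trans (leeD2r _ IN2))// -!EFinD lee_fin.
  by rewrite le_eqVlt; apply/orP; left; apply/eqP; ring.
by rewrite leeD2rE.
Qed.

(** Weighted AM-GM, [|D| <= D ^+ 2 / (e * m) + e * m], reduces the L1 norm to the second moment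
    without Cauchy-Schwarz; the first term integrates to at most [m / (e * m) = e^-1]. *)
Lemma sum_indic_L1 (m : nat) (e : R) : (0 < e)%R ->
  \int[P]_w `|\sum_(j < m) \1_(A j) w - m%:R * p|%R%:E
    <= (e * m%:R + e^-1)%:E.
Proof.
move=> e0; have [->|m0] := posnP m.
  under eq_integral do rewrite big_ord0 mul0r subrr normr0.
  by rewrite integral_cst_prob lee_fin mulr0 add0r invr_ge0 ltW.
have em0 : (0 < e * m%:R)%R by rewrite mulr_gt0// ltr0n.
set D := fun w => (\sum_(j < m) \1_(A j) w - m%:R * p)%R.
have mD : measurable_fun [set: T] D.
  apply: measurable_funB => //.
  by apply: measurable_sum => j; exact: measurable_indic.
have amgm w : (`|D w| <= (e * m%:R)^-1 * D w ^+ 2 + e * m%:R)%R.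
  rewrite -real_normK ?num_real//; set x := (`|D w|)%R.
  have x0 : (0 <= x)%R by exact: normr_ge0.
  rewrite -(ler_pM2l em0) mulrDr mulrA divff ?gt_eqF// mul1r.
  by nra.
apply: (@le_trans _ _ (\int[P]_w ((e * m%:R)^-1 * D w ^+ 2 + e * m%:R)%:E)).
  apply: ge0_le_integral_EFin => //; first exact: measurableT_comp.
  apply: measurable_funD => //; apply: measurable_funM => //.
  exact: measurable_funX.
rewrite ge0_integral_EFinD//; last 3 first.
- by apply: measurable_funM => //; exact: measurable_funX.
- by move=> w; rewrite mulr_ge0 ?sqr_ge0// invr_ge0 ltW.
- by move=> w; exact: ltW.
rewrite integral_cst_prob ge0_integral_EFinZl; last 3 first.
- exact: measurable_funX.
- by move=> w; exact: sqr_ge0.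
- by rewrite invr_ge0 ltW.
rewrite addeC EFinD leeD2l//.
apply: (@le_trans _ _ ((e * m%:R)^-1%:E * m%:R%:E)).
  by rewrite lee_wpmul2l ?sum_indic_L2// lee_fin invr_ge0 ltW.
rewrite -EFinM lee_fin invfM -mulrA mulVf ?mulr1//.
by rewrite pnatr_eq0 -lt0n.
Qed.

End IndicatorSums.

(** * L1 convergence of averages and its closure properties *)

Section L1Averages.
Context d (T : measurableType d) (R : realType) (P : probability T R).

(** Convergence of the averages to [a] in L1, multiplied through by [m] to avoid division. *)
Definition L1_average (Y : nat -> T -> R) (a : R) : Prop :=
  forall e : R, (0 < e)%R -> \forall m \near \oo,
    \int[P]_w `|\sum_(j < m) Y j w - m%:R * a|%R%:E <= (e * m%:R)%:E.

Lemma integral_normD (f g : T -> R) :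
  measurable_fun [set: T] f -> measurable_fun [set: T] g ->
  \int[P]_w `|f w + g w|%R%:E
    <= \int[P]_w `|f w|%R%:E + \int[P]_w `|g w|%R%:E.
Proof.
move=> mf mg; rewrite -ge0_integral_EFinD//; try exact: measurableT_comp.
apply: ge0_le_integral_EFin => //; try by move=> w; exact: ler_normD.
- by apply: measurableT_comp => //; exact: measurable_funD.
- by apply: measurable_funD; exact: measurableT_comp.
Qed.

Lemma measurable_fun_deviation (Y : nat -> T -> R) (m : nat) (c : R) :
  (forall j, measurable_fun [set: T] (Y j)) ->
  measurable_fun [set: T] (fun w => (\sum_(j < m) Y j w - c)%R).
Proof.
by move=> mY; apply: measurable_funB => //; exact: measurable_sum.
Qed.

Lemma L1_averageD (Y Z : nat -> T -> R) (a b : R) :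
  (forall j, measurable_fun [set: T] (Y j)) ->
  (forall j, measurable_fun [set: T] (Z j)) ->
  L1_average Y a -> L1_average Z b ->
  L1_average (fun j w => Y j w + Z j w)%R (a + b).
Proof.
move=> mY mZ Ya Zb e e0; have e20 : (0 < e / 2)%R by rewrite divr_gt0.
near=> m.
have YZ w : (\sum_(j < m) (Y j w + Z j w) - m%:R * (a + b) =
  (\sum_(j < m) Y j w - m%:R * a) + (\sum_(j < m) Z j w - m%:R * b))%R.
  by rewrite big_split/=; ring.
under eq_integral do rewrite YZ.
apply: le_trans.
  by apply: integral_normD; exact: measurable_fun_deviation.
rewrite [X in X%:E](_ : _ = e / 2 * m%:R + e / 2 * m%:R)%R; last by field.
by rewrite EFinD leeD//; near: m; [exact: Ya|exact: Zb].
Unshelve. all: by end_near. Qed.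

Lemma L1_averageZ (Y : nat -> T -> R) (a c : R) :
  (forall j, measurable_fun [set: T] (Y j)) ->
  L1_average Y a -> L1_average (fun j w => c * Y j w)%R (c * a).
Proof.
move=> mY Ya e e0.
(* The [+ 1] keeps the divisor positive when [c = 0]. *)
have c0 : (0 < `|c| + 1)%R by rewrite ltr_wpDl.
have ec : (0 < e / (`|c| + 1))%R by rewrite divr_gt0.
near=> m.
have YZ w : (`|\sum_(j < m) c * Y j w - m%:R * (c * a)| =
  `|c| * `|\sum_(j < m) Y j w - m%:R * a|)%R.
  by rewrite -normrM -mulr_sumr; congr `|_|%R; ring.
under eq_integral do rewrite YZ.
rewrite ge0_integral_EFinZl//; last first.
  by apply: measurableT_comp => //; exact: measurable_fun_deviation.
apply: (@le_trans _ _ (`|c|%:E * (e / (`|c| + 1) * m%:R)%:E)).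
  by rewrite lee_wpmul2l//; near: m; exact: Ya.
rewrite -EFinM lee_fin mulrA ler_wpM2r// mulrCA ger_pMr//.
by rewrite ler_pdivrMr// mul1r lerDl.
Unshelve. all: by end_near. Qed.

Lemma L1_average0 : L1_average (fun _ _ => 0%R) 0.
Proof.
move=> e e0; near=> m.
under eq_integral do rewrite big1// mulr0 subrr normr0.
by rewrite integral_cst_prob lee_fin mulr_ge0// ltW.
Unshelve. all: by end_near. Qed.

Lemma L1_average_sum (I : Type) (s : seq I) (Y : I -> nat -> T -> R)
    (a c : I -> R) :
  (forall i j, measurable_fun [set: T] (Y i j)) ->
  (forall i, L1_average (Y i) (a i)) ->
  L1_average (fun j w => \sum_(i <- s) c i * Y i j w)%R
    (\sum_(i <- s) c i * a i).
Proof.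
move=> mY Ya; elim: s => [|i s IH].
  rewrite big_nil; under eq_fun do under eq_fun do rewrite big_nil.
  exact: L1_average0.
rewrite big_cons; under eq_fun do under eq_fun do rewrite big_cons.
apply: (@L1_averageD (fun j w => c i * Y i j w)%R
  (fun j w => \sum_(k <- s) c k * Y k j w)%R) => //.
- by move=> j; exact: measurable_funM.
- by move=> j; apply: measurable_sum => k; exact: measurable_funM.
- exact: L1_averageZ.
Qed.

(** A three-term estimate: replacing [Y] by [Z], the deviation of [Z] from its own mean [b], and the
    shift from [b] to [a] cost [e / 3 * m] each. The first cost is linear in [m] because the
    approximation is uniform in [j]. *)
Lemma L1_average_approx (Y : nat -> T -> R) (a : R) :
  (forall j, measurable_fun [set: T] (Y j)) ->
  (forall e : R, (0 < e)%R -> exists Z b,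
     [/\ forall j, measurable_fun [set: T] (Z j), L1_average Z b,
       forall j, \int[P]_w `|Y j w - Z j w|%R%:E <= e%:E &
       (`|b - a| <= e)%R]) ->
  L1_average Y a.
Proof.
move=> mY approx e e0; have e30 : (0 < e / 3)%R by rewrite divr_gt0.
have [Z [b [mZ Zb YZ ba]]] := approx _ e30.
near=> m.
have dec w : (\sum_(j < m) Y j w - m%:R * a = \sum_(j < m) (Y j w - Z j w)
   + ((\sum_(j < m) Z j w - m%:R * b) + m%:R * (b - a)))%R.
  by rewrite sumrB; ring.
under eq_integral do rewrite dec.
have mYZ j : measurable_fun [set: T] (fun w => Y j w - Z j w)%R.
  exact: measurable_funB.
have mZb := measurable_fun_deviation m (m%:R * b) mZ.
apply: le_trans.
  apply: integral_normD; first exact: measurable_sum.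
  exact: measurable_funD.
rewrite [leRHS](_ : _ = (e / 3 * m%:R)%:E + ((e / 3 * m%:R)%:E + (e / 3 * m%:R)%:E)); last first.
  by rewrite -!EFinD; congr EFin; field.
apply: leeD.
  apply: (@le_trans _ _ (\int[P]_w (\sum_(j < m) `|Y j w - Z j w|)%R%:E)).
    apply: ge0_le_integral_EFin => //.
    - by apply: measurableT_comp => //; exact: measurable_sum.
    - by apply: measurable_sum => j; exact: measurableT_comp.
    - by move=> w; exact: ler_norm_sum.
  rewrite ge0_integral_EFin_sum//; last by move=> j; exact: measurableT_comp.
  rewrite [leRHS](_ : _ = \sum_(j < m) (e / 3)%:E); last first.
    by rewrite sumEFin sumr_const card_ord mulr_natr.
  by apply: lee_sum => j _; exact: YZ.
apply: (le_trans (integral_normD mZb (measurable_cst _))).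
rewrite leeD//; first by near: m; exact: Zb.
rewrite /= integral_cst_prob lee_fin normrM normr_nat mulrC.
by rewrite ler_wpM2r.
Unshelve. all: by end_near. Qed.

Lemma L1_average_indic (A : nat -> set T) (p : R) :
  (forall j, measurable (A j)) -> (forall j, P (A j) = p%:E) ->
  (forall j k, j != k -> P (A j `&` A k) = (p ^+ 2)%:E) ->
  L1_average (fun j => \1_(A j)) p.
Proof.
move=> mA PA PAA e e0; have e20 : (0 < e / 2)%R by rewrite divr_gt0.
near=> m.
rewrite (le_trans (sum_indic_L1 mA PA PAA m e20))// lee_fin.
(* From [m >= 4 / e ^+ 2] on, the constant [(e / 2)^-1] is at most [e / 2 * m]. *)
have : (2 / e / (e / 2) <= m%:R)%R by near: m; exact: nbhs_infty_ger.
rewrite ler_pdivrMr// => h.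
rewrite [leRHS](_ : _ = e / 2 * m%:R + e / 2 * m%:R)%R; last by field.
by rewrite lerD2l invf_div [leRHS]mulrC.
Unshelve. all: by end_near. Qed.

End L1Averages.

(** * The L1 weak law for pairwise independent, identically distributed variables *)

Section L1LawOfLargeNumbers.
Import HBSimple.
Context d (T : measurableType d) (R : realType) (P : probability T R).
Variables (Y : nat -> {RV P >-> R}) (X : {RV P >-> R}).
Hypothesis YX : forall j, identically_distributed (Y j) X.
Hypothesis YY : forall j k (A : set R), j != k -> measurable A ->
  P (Y j @^-1` A `&` Y k @^-1` A) = P (Y j @^-1` A) * P (Y k @^-1` A).

Lemma L1_average_preimage (A : set R) : measurable A ->
  L1_average P (fun j => \1_(Y j @^-1` A)) (fine (P (X @^-1` A))).
Proof.
move=> mA.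
have mYA j : measurable (Y j @^-1` A) by exact: measurable_funPTI.
have PY j : P (Y j @^-1` A) = (fine (P (X @^-1` A)))%:E.
  rewrite fineK; last by apply: fin_num_measure; exact: measurable_funPTI.
  exact: YX.
by apply: L1_average_indic => // j k jk; rewrite YY// !PY -EFinM expr2.
Qed.

Lemma identically_distributed_integral (f : R -> R) (j : nat) :
  measurable_fun [set: R] f -> (forall x, (0 <= f x)%R) ->
  \int[P]_w (f (Y j w))%:E = \int[P]_w (f (X w))%:E.
Proof.
move=> mf f0; have mfE : measurable_fun [set: R] (EFin \o f).
  exact/measurable_EFinP.
rewrite -(@ge0_integral_distribution _ _ _ _ _ P (Y j) (EFin \o f))//.
rewrite -(@ge0_integral_distribution _ _ _ _ _ P X (EFin \o f))//.
by apply: eq_measure_integral => A mA _; exact: YX.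
Qed.

(** A simple function is the finite sum of its values times the indicators of its fibres, so both
    claims follow by linearity from the case of indicators. *)
Lemma L1_average_sfun (g : {sfun R >-> R}) :
  P.-integrable [set: T] (EFin \o (g \o X)) /\
  L1_average P (fun j => g \o Y j) (fine ('E_P[g \o X])).
Proof.
have mg y : measurable (g @^-1` [set y]) by exact: measurable_funPTI.
have gE x : (g x = \sum_(y <- fset_set (range g)) y * \1_(g @^-1` [set y]) x)%R.
  by rewrite fimfunE fsbig_finite.
have iX y : P.-integrable [set: T] (fun w => (\1_(X @^-1` (g @^-1` [set y])) w)%:E).
  by apply: integrable_indic; exact: measurable_funPTI.
have gX w : (g (X w))%:E = \sum_(y <- fset_set (range g))
    y%:E * (\1_(X @^-1` (g @^-1` [set y])) w)%:E.
  by rewrite gE -sumEFin; apply: eq_bigr => y _; rewrite EFinM.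
split.
  apply: (eq_integrable _ (fun w => \sum_(y <- fset_set (range g))
    y%:E * (\1_(X @^-1` (g @^-1` [set y])) w)%:E)) => //.
    by move=> w _; rewrite -gX.
  by apply: integrable_sum => // => y _; exact: integrableZl.
have -> : 'E_P[g \o X] =
    (\sum_(y <- fset_set (range g)) y * fine (P (X @^-1` (g @^-1` [set y]))))%:E.
  rewrite unlock; under eq_integral do rewrite /= gX.
  rewrite integral_sum//; last by move=> y; exact: integrableZl.
  rewrite -sumEFin; apply: eq_bigr => y _.
  rewrite integralZl// integral_indic//=; last exact: measurable_funPTI.
  rewrite setIT EFinM fineK//; apply: fin_num_measure; exact: measurable_funPTI.
rewrite [X in L1_average _ X](_ : _ = fun j w =>
    \sum_(y <- fset_set (range g)) y * \1_(Y j @^-1` (g @^-1` [set y])) w)%R.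
  apply: L1_average_sum => [y j|y]; last exact: L1_average_preimage.
  by apply: measurable_indic; exact: measurable_funPTI.
by apply/funext => j; apply/funext => w /=; rewrite gE.
Qed.

(** The identity is approximated by a simple [g] in L1 of the law of [X]. All [Y j] share this law,
    so the same [g] gives the same error for every [j]. *)
Lemma L1_lln : P.-integrable [set: T] (EFin \o X) ->
  L1_average P Y (fine 'E_P[X]).
Proof.
move=> iX; apply: L1_average_approx => [j|e e0]; first exact: measurable_funPT.
have iid : (distribution P X).-integrable [set: R] (EFin \o idfun).
  apply: integrable_pushforward => //.
  by apply/measurable_EFinP; exact: measurable_id.
have [g_ [_ _ g0]] := approximation_sfun_integrable measurableT iid.
have [n gn] : exists n, \int[distribution P X]_x `|x - g_ n x|%R%:E <= e%:E.
  have /g0[n _ /(_ n (leqnn n)) h] : nbhs (0 : \bar R) (fun u => u < e%:E).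
    by apply: open_ereal_lt'; rewrite lte_fin.
  by exists n; exact: ltW.
set g := g_ n in gn.
have [igX gL1] := L1_average_sfun g.
have mdist : measurable_fun [set: R] (fun x => `|x - g x|%R).
  by apply: measurableT_comp => //; exact: measurable_funB.
have Xg : \int[P]_w `|X w - g (X w)|%R%:E <= e%:E.
  move: gn; rewrite ge0_integral_distribution//; exact/measurable_EFinP.
exists (fun j => g \o Y j), (fine 'E_P[g \o X]); split => //.
- by move=> j; rewrite (identically_distributed_integral j mdist).
- have iB : P.-integrable [set: T] (fun w => (g (X w))%:E - (X w)%:E).
    exact: (integrableB measurableT igX iX).
  rewrite -lee_fin; apply: le_trans Xg.
  rewrite unlock -fineB; [|exact: integrable_fin_num..].
  rewrite -integralB_EFin// -abse_EFin fineK; last exact: integrable_fin_num.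
  apply: (le_trans (le_abse_integral _ _ _)) => //; first exact: measurable_int iB.
  by under eq_integral do rewrite -EFinB abse_EFin distrC.
Qed.

End L1LawOfLargeNumbers.

(** * Pathwise bounds on the time of the n-th push *)

Section PushTimes.
Variables (R : realType) (P : nat) (x : 'I_P -> nat -> R).

(** Applied later at every sample point, including the null set where positivity of the times fails.
    An empty set has [inf] equal to 0. *)
Lemma nth_push_time_ge0 n : (0 <= nth_push_time x n)%R.
Proof.
rewrite /nth_push_time; set S := [set t : R | _].
have [->|/set0P S0] := eqVneq S set0; first by rewrite inf0.
by apply: lb_le_inf => // t [].
Qed.

Hypothesis P_gt0 : (0 < P)%N.
Hypothesis x_gt0 : forall i k, (0 < x i k)%R.

Lemma push_time_ge0 i k : (0 <= push_time x i k)%R.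
Proof. by apply: sumr_ge0 => j _; exact: ltW. Qed.

Lemma push_time_mono i :
  {homo push_time x i : k l / (k <= l)%N >-> (k <= l)%R}.
Proof.
apply: homo_leq => [k|k l m|k]; [exact: lexx|exact: le_trans|].
by rewrite /push_time [leRHS]big_ord_recr/= lerDl ltW.
Qed.

Variable n : nat.
Hypothesis n_gt0 : (0 < n)%N.
(** Pushes are numbered from 0, so [push_time x i q] is the time of the [q.+1]-st push of worker
    [i]. *)
Let q := (n.-1 %/ P)%N.

Lemma card_le_pushes_by (t : R) : (forall i, push_time x i q <= t)%R ->
  (`I_n #<= pushes_by x t)%card.
Proof.
move=> qt.
(* Round-robin numbering: the [r]-th push is assigned to worker [r] mod [P], and [r < n] gives
   [r %/ P <= q]. *)
pose f (r : nat) : 'I_P * nat := (Ordinal (ltn_pmod r P_gt0), (r %/ P)%N).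
have fI : {in `I_n &, injective f}.
  move=> r s _ _ [rs1 rs2].
  by rewrite (divn_eq r P) (divn_eq s P) rs1 rs2.
have := inj_card_eq fI; rewrite card_eq_sym card_eq_le => /andP[nf _].
apply: (card_le_trans nf); apply: subset_card_le => _ [r /= rn <-].
apply: le_trans (qt _); apply: push_time_mono; apply: leq_div2r.
by rewrite -ltnS prednK.
Qed.

Lemma pushes_by_card_le (t : R) : (`I_n #<= pushes_by x t)%card ->
  exists i, (push_time x i q <= t)%R.
Proof.
move=> nt; apply: contrapT => /forallNP qt.
(* If every worker makes push [q] after [t], the pushes up to [t] lie in [B], which embeds into
   [q * P < n] integers by the inverse of the round-robin numbering. *)
pose B := [set p : 'I_P * nat | (p.2 < q)%N].
have tB : pushes_by x t `<=` B.
  move=> [i k] /= ikt; rewrite /B/= ltnNge; apply/negP => qk.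
  by apply: (qt i); apply: le_trans ikt; exact: push_time_mono.
pose f (p : 'I_P * nat) := (p.2 * P + p.1)%N.
have fI : {in B &, injective f}.
  move=> [i k] [j l] _ _ /= fE.
  have /eqP := congr1 (modn^~ P) fE; rewrite /f/= !modnMDl !modn_small// => /eqP ij.
  have := congr1 (divn^~ P) fE; rewrite /f/= !divnMDl// !divn_small// !addn0 => ->.
  by congr pair; exact: val_inj.
have := inj_card_eq fI; rewrite card_eq_sym card_eq_le => /andP[Bf _].
have fB : [set f p | p in B] `<=` `I_(q * P).
  move=> _ [[i k] /= kq <-] /=; rewrite /f/=.
  apply: (@leq_trans (k.+1 * P)); last by rewrite leq_mul2r kq orbT.
  by rewrite mulSn addnC ltn_add2r.
have := card_le_trans nt (card_le_trans (subset_card_le tB)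
  (card_le_trans Bf (subset_card_le fB))).
rewrite card_le_II leqNgt => /negP; apply.
by rewrite (leq_ltn_trans (leq_divM _ _))// prednK.
Qed.

Lemma nth_push_time_le_max :
  exists i, (nth_push_time x n <= push_time x i q)%R.
Proof.
pose i0 := Ordinal P_gt0.
have [i _ imax] := @arg_maxP _ _ _ i0 xpredT (fun i => push_time x i q) isT.
exists i; apply: ge_inf; first by exists 0%R => t [].
split; first exact: push_time_ge0.
by apply: card_le_pushes_by => j; exact: imax.
Qed.

Lemma nth_push_time_ge_min :
  exists i, (push_time x i q <= nth_push_time x n)%R.
Proof.
pose i0 := Ordinal P_gt0.
have [i _ imin] := @arg_minP _ _ _ i0 xpredT (fun i => push_time x i q) isT.
exists i; apply: lb_le_inf => [|t [_ /pushes_by_card_le[j jt]]]; last first.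
  exact: le_trans (imin j isT) jt.
(* [lb_le_inf] needs a nonempty set; the sum dominates every worker's push [q]. *)
exists (\sum_j push_time x j q)%R; split.
  by apply: sumr_ge0 => j _; exact: push_time_ge0.
apply: card_le_pushes_by => j; rewrite (bigD1 j)//= lerDl.
by apply: sumr_ge0 => k _; exact: push_time_ge0.
Qed.

(** The push time lies between two of the workers' times, so one of these is at least as far from
    [c]. The sum over workers replaces the maximum because it integrates termwise. *)
Lemma nth_push_time_deviation (c : R) :
  (`|nth_push_time x n - c| <= \sum_i `|push_time x i q - c|)%R.
Proof.
have dev i : (`|push_time x i q - c| <= \sum_i `|push_time x i q - c|)%R.
  by rewrite (bigD1 i)//= lerDl; apply: sumr_ge0.
have [i iub] := nth_push_time_le_max; have [j jlb] := nth_push_time_ge_min.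
move: (dev i) (dev j); set D := (X in _ -> _ -> (_ <= X)%R).
rewrite !ler_norml => /andP[_ iD] /andP[jD _].
apply/andP; split.
- by apply: le_trans jD _; rewrite lerD2r.
- by apply: le_trans _ iD; rewrite lerD2r.
Qed.

End PushTimes.

(** * Integral estimates for possibly nonmeasurable functions *)

Section NonmeasurableIntegrands.
Import HBNNSimple.

(* The integral of a nonnegative function is a supremum over the simple
   functions below it, hence monotone for arbitrary integrands. This avoids
   proving that [nth_push_time] is measurable in the sample point. *)
Lemma ge0_le_integral_nonmeasurable d (T : measurableType d) (R : realType)
    (mu : {measure set T -> \bar R}) (f g : T -> \bar R) :
  (forall w, 0 <= f w) -> (forall w, f w <= g w) ->
  \int[mu]_w f w <= \int[mu]_w g w.
Proof.
move=> f0 fg; rewrite !ge0_integralTE//; last first.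
  by move=> w; exact: le_trans (fg w).
apply: le_ereal_sup => _ [h /= hf <-]; exists h => //= w.
exact: le_trans (fg w).
Qed.

(** Additivity is not applied to [f], whose measurability is not assumed. Both bounds pass through
    measurable functions below [f]: all simple ones for the upper bound, one explicit minorant for
    the lower. *)
Lemma integral_deviation d (T : measurableType d) (R : realType)
    (P : probability T R) (f D : T -> R) (c b : R) :
  (forall w, (0 <= f w)%R) -> (0 <= c)%R ->
  measurable_fun [set: T] D -> (forall w, (0 <= D w)%R) ->
  {ae P, forall w, (`|f w - c| <= D w)%R} ->
  \int[P]_w (D w)%:E <= b%:E ->
  \int[P]_w (f w)%:E \is a fin_num /\ (`|fine (\int[P]_w (f w)%:E) - c| <= b)%R.
Proof.
move=> f0 c0 mD D0 fD Db.
have ub : \int[P]_w (f w)%:E <= (c + b)%:E.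
  apply: (@le_trans _ _ (\int[P]_w (c + D w)%:E)); last first.
    by rewrite ge0_integral_EFinD// integral_cst_prob EFinD leeD2l.
  rewrite ge0_integralTE//; apply: ge_ereal_sup => _ [h /= hf <-].
  rewrite -[leLHS]integralT_nnsfun.
  apply: ae_ge0_le_integral => //.
  - by move=> w _; rewrite lee_fin; exact: fun_ge0.
  - by apply/measurable_EFinP; exact: measurable_funPT.
  - by move=> w _; rewrite lee_fin addr_ge0.
  - by apply/measurable_EFinP; exact: measurable_funD.
  apply: filterS fD => w; rewrite ler_norml => /andP[_ fwD] _.
  by rewrite (le_trans (hf w))// lee_fin -lerBlDl.
have lb : c%:E <= \int[P]_w (f w)%:E + b%:E.
  have [N [mN N0 fN]] := fD.
  pose g w := (Num.max 0 (c - D w) * \1_(~` N) w)%R.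
  have mg : measurable_fun [set: T] g.
    apply: measurable_funM; last by apply: measurable_indic; exact: measurableC.
    by apply: measurable_maxr => //; exact: measurable_funB.
  have g0 w : (0 <= g w)%R by rewrite mulr_ge0// ?le_max ?lexx// indicE.
  have gf w : (g w <= f w)%R.
    rewrite /g indicE; have [wN|wN] := boolP (w \in ~` N); last by rewrite mulr0.
    rewrite mulr1 ge_max f0/=.
    have : (`|f w - c| <= D w)%R.
      by apply: contrapT => h; move: wN; rewrite inE; apply; exact: fN.
    by rewrite ler_norml => /andP[h _]; lra.
  apply: (@le_trans _ _ (\int[P]_w (g w + D w)%:E)); last first.
    rewrite ge0_integral_EFinD// leeD//.
    apply: ge0_le_integral_nonmeasurable => w; rewrite lee_fin//.
  rewrite -(integral_cst_prob P c).
  apply: ae_ge0_le_integral => //.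
  - by move=> w _; rewrite lee_fin addr_ge0.
  - by apply/measurable_EFinP; exact: measurable_funD.
  exists N; split=> // w /= h; apply: contrapT => wN; apply: h => _.
  rewrite lee_fin /g indicE mem_set// mulr1 -lerBlDr le_max lexx orbT//.
have If0 : 0 <= \int[P]_w (f w)%:E by apply: integral_ge0 => w _; rewrite lee_fin.
have fin : \int[P]_w (f w)%:E \is a fin_num.
  by rewrite ge0_fin_numE// (le_lt_trans ub)// ltry.
split=> //; move: ub lb; rewrite -(fineK fin) -EFinD !lee_fin => ub lb.
by rewrite ler_norml; apply/andP; split; lra.
Qed.

End NonmeasurableIntegrands.

(** * Asymptotics of the expected time of the n-th push *)

Section NthPushTime.
Context d (Omega : measurableType d) (R : realType).
Variables (Pr : probability Omega R) (P : nat).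
Variables (X : {RV Pr >-> R}) (tau : 'I_P -> nat -> {RV Pr >-> R}).
Hypothesis P_gt0 : (0 < P)%N.
Hypothesis tau_iid : iid_as (fun p : 'I_P * nat => tau p.1 p.2) X.
Hypothesis tau_gt0 : forall i k, {ae Pr, forall w, (0 < tau i k w)%R}.
Hypothesis EX_lty : 'E_Pr[X] < +oo.

(** Positivity is given for the [tau i k]; it passes to [X] because the common law gives the
    nonpositive reals the same mass. *)
Lemma iid_gt0 : {ae Pr, forall w, (0 < X w)%R}.
Proof.
have mN : measurable [set x : R | (x <= 0)%R] by rewrite -set_itvNyc.
have [N [mN' N0 tauN]] := tau_gt0 (Ordinal P_gt0) 0%N.
exists (X @^-1` [set x : R | (x <= 0)%R]); split.
- exact: measurable_funPTI.
- have tauX : Pr (tau (Ordinal P_gt0) 0%N @^-1` [set x : R | (x <= 0)%R]) =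
      Pr (X @^-1` [set x : R | (x <= 0)%R]).
    exact: (tau_iid.2 (Ordinal P_gt0, 0%N)).
  rewrite -tauX.
  apply: (subset_measure0 (mu := Pr) _ mN' _ N0); first exact: measurable_funPTI.
  by move=> w /= tw; apply: tauN => /=; rewrite ltNge tw.
- by move=> w /= /negP; rewrite -leNgt.
Qed.

Lemma iid_expectation_norm : 'E_Pr[X] = \int[Pr]_w `|X w|%R%:E.
Proof.
have mX : measurable_fun [set: Omega] X by exact: measurable_funPT.
rewrite unlock; apply: ae_eq_integral => //.
- exact/measurable_EFinP.
- by apply/measurable_EFinP; exact: measurableT_comp.
by apply: filterS iid_gt0 => w X0 _; rewrite gtr0_norm.
Qed.

Lemma iid_integrable : Pr.-integrable [set: Omega] (EFin \o X).
Proof.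
apply/integrableP; split; first by apply/measurable_EFinP; exact: measurable_funPT.
by rewrite (eq_integral (fun w => `|X w|%R%:E))// -iid_expectation_norm.
Qed.

Lemma iid_L1_average i : L1_average Pr (tau i) (fine 'E_Pr[X]).
Proof.
apply: L1_lln iid_integrable => [j|j k A jk mA]; first exact: (tau_iid.2 (i, j)).
(* Pairwise independence is joint independence over a two-element index set. *)
have := tau_iid.1 [fset (i, j); (i, k)]%fset (fun=> A) (fun=> mA).
rewrite big_fsetU1 ?big_seq_fset1/=; last by rewrite inE xpair_eqE eqxx.
move=> <-; congr (Pr _); apply/seteqP; split=> [w [jA kA] p /=|w h].
  by rewrite !inE => /orP[] /eqP ->.
by split; [apply: (h (i, j))|apply: (h (i, k))]; rewrite /= !inE eqxx ?orbT.
Qed.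

Lemma iid_mean_ge0 : (0 <= fine 'E_Pr[X])%R.
Proof.
apply: fine_ge0; rewrite iid_expectation_norm.
by apply: integral_ge0 => w _; rewrite lee_fin.
Qed.

Lemma expectation_nth_push_time (e : R) : (0 < e)%R -> \forall n \near \oo,
  let ES := 'E_Pr[fun w => nth_push_time (fun i k => tau i k w) n] in
  ES \is a fin_num /\
  (`|fine ES - n%:R * (fine 'E_Pr[X] / P%:R)| <= e * n%:R)%R.
Proof.
move=> e0; set mu := fine 'E_Pr[X]; have mu0 : (0 <= mu)%R := iid_mean_ge0.
have P0 : (0 < P%:R :> R)%R by rewrite ltr0n.
have e2P : (0 < e / 2 / P%:R)%R by rewrite !divr_gt0.
(* Finitely many workers share one threshold [M]. The tolerance [e / 2 / P] adds up to [e / 2] over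
   them. *)
have /filter_forall[M _ LLN] i : \forall m \near \oo,
    \int[Pr]_w `|\sum_(j < m) tau i j w - m%:R * mu|%R%:E
      <= (e / 2 / P%:R * m%:R)%:E.
  exact: iid_L1_average.
near=> n.
have n0 : (0 < n)%N by near: n; exact: nbhs_infty_gt.
(* This yields [M <= m] below; the next bound lets [e / 2 * n] absorb a rounding error of [mu]. *)
have Mn : (M * P <= n)%N by near: n; exact: nbhs_infty_ge.
have mun : (mu / (e / 2) <= n%:R)%R by near: n; exact: nbhs_infty_ger.
set m := (n.-1 %/ P).+1.
have nm : (n <= m * P)%N by rewrite -(prednK n0) ltn_ceil.
have mP : (m * P <= n + P)%N.
  by rewrite mulSn addnC leq_add2r (leq_trans (leq_divM _ _))// leq_pred.
have mn : (m <= n)%N by rewrite -(prednK n0) ltnS leq_div.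
have Mm : (M <= m)%N by rewrite -(leq_pmul2r P_gt0) (leq_trans Mn).
pose D w : R := (\sum_i `|\sum_(j < m) tau i j w - m%:R * mu|)%R.
have mdev i : measurable_fun [set: Omega]
    (fun w => `|\sum_(j < m) tau i j w - m%:R * mu|%R).
  apply: measurableT_comp => //.
  exact: (measurable_fun_deviation _ _ (fun j => measurable_funPT (tau i j))).
have ID : \int[Pr]_w (D w)%:E <= (e / 2 * n%:R)%:E.
  rewrite ge0_integral_EFin_sum//.
  apply: (@le_trans _ _ (\sum_(i < P) (e / 2 / P%:R * m%:R)%:E)).
    by apply: lee_sum => i _; exact: LLN.
  rewrite sumEFin sumr_const card_ord -(mulr_natl _ P) lee_fin.
  rewrite [leLHS](_ : _ = e / 2 * m%:R)%R; last by field; rewrite gt_eqF.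
  by rewrite ler_pM2l ?divr_gt0// ler_nat.
have dev : {ae Pr, forall w,
    (`|nth_push_time (fun i k => tau i k w) n - m%:R * mu| <= D w)%R}.
  have /filter_forall tau0 i : {ae Pr, forall w, forall k, (0 < tau i k w)%R}.
    exact: ae_foralln.
  by apply: filterS tau0 => w tau0; exact: nth_push_time_deviation.
have [||||fin ESm] := integral_deviation _ _ _ _ dev ID.
- by move=> w; exact: nth_push_time_ge0.
- by rewrite mulr_ge0.
- exact: measurable_sum.
- by move=> w; exact: sumr_ge0.
rewrite unlock; split => //.
rewrite -[X in (`|X|)%R](subrKA (m%:R * mu)) (le_trans (ler_normD _ _))//.
rewrite [leRHS](_ : _ = e / 2 * n%:R + e / 2 * n%:R)%R; last by field.
(* Rounding error: [0 <= m * P - n <= P], so [m * mu] and [n * (mu / P)] differ by at most [mu]. *)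
rewrite lerD//; apply: (@le_trans _ _ mu).
  rewrite (_ : _ - _ = (m%:R * P%:R - n%:R) / P%:R * mu)%R; last first.
    by field; rewrite gt_eqF.
  rewrite ger0_norm; last first.
    by rewrite !mulr_ge0 ?invr_ge0 ?(ltW P0)// subr_ge0 -natrM ler_nat.
  rewrite ler_piMl// ler_pdivrMr// mul1r lerBlDl -natrM -natrD ler_nat//.
by rewrite mulrC -ler_pdivrMr// divr_gt0.
Unshelve. all: by end_near. Qed.

End NthPushTime.

(** * From pushes to iterations *)

Theorem lemma5 (R : realType) (d : measure_display) (Omega : measurableType d)
    (Pr : probability Omega R) (K P : nat)
    (X : {RV Pr >-> R}) (tau : 'I_P -> nat -> {RV Pr >-> R}) :
  (1 <= K)%N -> (1 <= P)%N ->
  iid_as (fun p : 'I_P * nat => tau p.1 p.2) X ->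
  (forall i k, {ae Pr, forall w, (0 < tau i k w)%R}) ->
  0 < 'E_Pr[X] -> 'E_Pr[X] < +oo ->
  (fun J : nat =>
     'E_Pr[fun w => update_time (fun i k => tau i k w) K J] / J%:R%:E)
    @ \oo --> K%:R%:E * 'E_Pr[X] / P%:R%:E.
Proof.
move=> K0 P0 tau_iid tau_gt0 EX0 EX_lty.
have EXfin : 'E_Pr[X] \is a fin_num by rewrite ge0_fin_numE// ltW.
have KR0 : (0 < K%:R :> R)%R by rewrite ltr0n.
set mu := fine 'E_Pr[X].
have -> : K%:R%:E * 'E_Pr[X] / P%:R%:E = (K%:R * (mu / P%:R))%:E.
  by rewrite -(fineK EXfin) -EFinM inver pnatr_eq0 (gtn_eqF P0) -EFinM mulrA.
have ET e : (0 < e)%R -> \forall J \near \oo,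
    let ES := 'E_Pr[fun w => update_time (fun i k => tau i k w) K J] in
    ES / J%:R%:E \is a fin_num /\
    (`|K%:R * (mu / P%:R) - fine (ES / J%:R%:E)| <= e)%R.
  move=> e0.
  (* With tolerance [e / K], the error at [n = J * K] pushes is [e * J], hence [e] after division by
     [J]. *)
  have [M _ ESM] := expectation_nth_push_time P0 tau_iid tau_gt0 EX_lty
    (divr_gt0 e0 KR0).
  near=> J; have J0 : (0 < J)%N by near: J; exact: nbhs_infty_gt.
  have JR0 : (0 < J%:R :> R)%R by rewrite ltr0n.
  have [|fin ESJ] := ESM (J * K)%N.
    rewrite /= (@leq_trans J)//; first by near: J; exact: nbhs_infty_ge.
    by rewrite leq_pmulr.
  rewrite /update_time -(fineK fin) inver gt_eqF// -EFinM.
  split=> //=; rewrite -(ler_pM2r JR0) -[X in (_ * X)%R](ger0_norm (ltW JR0)).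
  rewrite -normrM distrC in ESJ *.
  apply: le_trans (le_trans ESJ _).
    rewrite le_eqVlt; apply/orP; left; apply/eqP; congr (`|_|)%R.
    by rewrite mulrBl divfK ?gt_eqF// natrM (mulrC J%:R) mulrAC.
  by rewrite natrM le_eqVlt; apply/orP; left; apply/eqP; field; rewrite gt_eqF.
apply/fine_cvgP; split.
  by apply: filterS (ET 1%R ltr01) => J [].
apply/cvgrPdist_le => e e0.
by apply: filterS (ET e e0) => J [].
Unshelve. all: by end_near. Qed.
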